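(* Let $\{\Lambda_i\}_{i\in\mathbb{N}}$ be a countable system of arbitrary closed cones in $\mathbb{R}^n$ satisfying the normal qualification condition at the origin, and let $\Lambda:=\bigcap_{i=1}^\infty\Lambda_i$. Then $$\operatorname{int}\widehat N(0;\Lambda)\subset\Big\{\sum_{i=1}^{\infty}x_i^*\ \Big|\ x_i^*\in N(0;\Lambda_i)\Big\}$$ and $$\widehat N(0;\Lambda)\subset\operatorname{cl}\Big\{\sum_{i\in I}x_i^*\ \Big|\ x_i^*\in N(0;\Lambda_i),\ I\in\mathcal{L}\Big\},$$ where $\mathcal{L}$ stands for the collection of all finite subsets of $\mathbb{N}$.
   Context: $\mathbb{R}^n$ carries the Euclidean norm $\|\cdot\|$ and is identified with its dual; $\mathbb{N}=\{1,2,\ldots\}$. A cone is a set $\Lambda$ with $0\in\Lambda$ and $\lambda v\in\Lambda$ whenever $v\in\Lambda$, $\lambda\ge 0$; cones need not be convex. Infinite sums are sums of convergent series. $\operatorname{int}$ and $\operatorname{cl}$ denote interior and closure. For $\Omega\subset\mathbb{R}^n$, $\bar x\in\Omega$, $\varepsilon\ge 0$, the set of $\varepsilon$-normals is $$\widehat N_\varepsilon(\bar x;\Omega)=\Big\{x^*\Big|\ \limsup_{x\to\bar x,\,x\in\Omega,\,x\neq\bar x}\frac{\langle x^*,x-\bar x\rangle}{\|x-\bar x\|}\le\varepsilon\Big\}$$ (the condition being vacuous if $\bar x$ is isolated in $\Omega$), and $\widehat N(\bar x;\Omega):=\widehat N_0(\bar x;\Omega)$ is the Fréchet normal cone. The limiting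 normal cone $N(\bar x;\Omega)$ is the set of all $x^*$ for which there are sequences $\varepsilon_k\downarrow 0$, $x_k\to\bar x$ with $x_k\in\Omega$, and $x_k^*\to x^*$ with $x_k^*\in\widehat N_{\varepsilon_k}(x_k;\Omega)$ for all $k$. Normal qualification condition at the origin for $\{\Lambda_i\}_{i\in\mathbb{N}}$: whenever $x_i^*\in N(0;\Lambda_i)$ for all $i\in\mathbb{N}$ and $\sum_{i=1}^\infty x_i^*=0$, one has $x_i^*=0$ for all $i\in\mathbb{N}$. *)

(* Defs.v *)
From mathcomp Require Import all_boot all_order all_algebra.
From mathcomp Require Import all_classical all_reals all_analysis.

Set Implicit Arguments.
Unset Strict Implicit.
Unset Printing Implicit Defensive.

Import Order.TTheory GRing.Theory Num.Theory.
Import numFieldNormedType.Exports.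

Local Open Scope classical_set_scope.
Local Open Scope ring_scope.

(* The library norm on 'rV[R]_n is the sup norm; the Euclidean one, which the
   definition of eps-normals uses, is given here. Both induce the library
   topology of 'rV[R]_n, so limits, interior and closure are the library's. *)
Definition dot (R : realType) (n : nat) (u v : 'rV[R]_n) : R :=
  \sum_(j < n) u 0 j * v 0 j.

Definition enorm (R : realType) (n : nat) (u : 'rV[R]_n) : R :=
  Num.sqrt (dot u u).

Definition is_cone (R : realType) (n : nat) (L : set 'rV[R]_n) : Prop :=
  L 0 /\ forall (a : R) (v : 'rV[R]_n), 0 <= a -> L v -> L (a *: v).

(* The filter [within Omega xbar^'] is that of x --> xbar with x in Omega and
   x != xbar. If xbar is isolated in Omega it contains set0, the limsup is -oo
   and the condition is vacuous. *)
Definition eps_normal (R : realType) (n : nat) (eps : R) (xbar : 'rV[R]_n)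
    (Omega : set 'rV[R]_n) : set 'rV[R]_n :=
  [set xs | (limf_esup (fun x : 'rV[R]_n => (dot xs (x - xbar) / enorm (x - xbar))%:E)
               (within Omega xbar^') <= eps%:E)%E].

Definition frechet_normal (R : realType) (n : nat) (xbar : 'rV[R]_n)
    (Omega : set 'rV[R]_n) : set 'rV[R]_n :=
  eps_normal 0 xbar Omega.

Definition limiting_normal (R : realType) (n : nat) (xbar : 'rV[R]_n)
    (Omega : set 'rV[R]_n) : set 'rV[R]_n :=
  [set xs | exists (eps : nat -> R) (x : nat -> 'rV[R]_n)
                   (y : nat -> 'rV[R]_n),
    [/\ (forall k, 0 <= eps k), nonincreasing_seq eps & eps @ \oo --> (0 : R)] /\
    [/\ (forall k, Omega (x k)), x @ \oo --> xbar, y @ \oo --> xs &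
        forall k, eps_normal (eps k) (x k) Omega (y k)]].

(* Families are indexed by nat from 0; [series x @ \oo --> s] says that the
   partial sums of x converge to s. *)
Definition normal_qualification (R : realType) (n : nat)
    (L : nat -> set 'rV[R]_n) : Prop :=
  forall x : nat -> 'rV[R]_n,
    (forall i, limiting_normal 0 (L i) (x i)) ->
    series x @ \oo --> (0 : 'rV[R]_n) ->
    forall i, x i = 0.

Definition normal_series_sums (R : realType) (n : nat)
    (L : nat -> set 'rV[R]_n) : set 'rV[R]_n :=
  [set s | exists x : nat -> 'rV[R]_n,
    (forall i, limiting_normal 0 (L i) (x i)) /\ series x @ \oo --> s].

Definition normal_finite_sums (R : realType) (n : nat)
    (L : nat -> set 'rV[R]_n) : set 'rV[R]_n :=
  [set s | exists (I : set nat) (x : nat -> 'rV[R]_n),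
    [/\ finite_set I, (forall i, I i -> limiting_normal 0 (L i) (x i)) &
        s = \sum_(i \in I) x i]].

(* Main.v *)
(** Suppose [<xs, v> < e |v|] for all nonzero [v] in the intersection of the
    cones. By compactness of the unit sphere, finitely many of the cones have no
    common point where [<xs, v> >= e |v|], with a uniform margin. Hence
    [e |x| - <xs, x> + 1/2 sum_(i < N) |x - w_i|^2], as a function of [x] and
    [w_i] in [L i], is coercive and has a minimizer. Minimality in [w_i] makes
    [w_i] a Euclidean projection of [x], so [x - w_i] is a limiting normal to
    [L i] at 0; minimality in [x] says that [xs] is within [e] of the sum of
    these normals. The hypothesis holds with [e = 0] if [xs] is interior to the
    Frechet normal cone, and with every [e > 0] if [xs] merely belongs to it. *)
Require Import Defs.
From mathcomp Require Import all_boot all_order all_algebra.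
From mathcomp Require Import all_classical all_reals all_analysis.
From mathcomp Require Import ring lra.
Set Implicit Arguments.
Unset Strict Implicit.
Unset Printing Implicit Defensive.

Import Order.TTheory GRing.Theory Num.Theory.
Import numFieldNormedType.Exports.
Local Open Scope classical_set_scope.
Local Open Scope ring_scope.

(** * Euclidean inner product and its comparison with the sup norm *)

Lemma dotC (R : realType) (n : nat) (u v : 'rV[R]_n) : dot u v = dot v u.
Proof. by apply: eq_bigr => j _; rewrite mulrC. Qed.

Lemma dotDl (R : realType) (n : nat) (u v w : 'rV[R]_n) :
  dot (u + v) w = dot u w + dot v w.
Proof.
by rewrite /dot -big_split; apply: eq_bigr => j _ /=; rewrite mxE mulrDl.
Qed.

Lemma dotZl (R : realType) (n : nat) (a : R) (u v : 'rV[R]_n) :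
  dot (a *: u) v = a * dot u v.
Proof.
by rewrite /dot big_distrr; apply: eq_bigr => j _ /=; rewrite mxE mulrA.
Qed.

Lemma dotNl (R : realType) (n : nat) (u v : 'rV[R]_n) : dot (- u) v = - dot u v.
Proof. by rewrite -scaleN1r dotZl mulN1r. Qed.

Lemma dotDr (R : realType) (n : nat) (u v w : 'rV[R]_n) :
  dot u (v + w) = dot u v + dot u w.
Proof. by rewrite dotC dotDl !(dotC _ u). Qed.

Lemma dotZr (R : realType) (n : nat) (a : R) (u v : 'rV[R]_n) :
  dot u (a *: v) = a * dot u v.
Proof. by rewrite dotC dotZl dotC. Qed.

Lemma dotNr (R : realType) (n : nat) (u v : 'rV[R]_n) : dot u (- v) = - dot u v.
Proof. by rewrite dotC dotNl dotC. Qed.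

Lemma dotr0 (R : realType) (n : nat) (u : 'rV[R]_n) : dot u 0 = 0.
Proof. by rewrite -(scale0r 0) dotZr mul0r. Qed.

Lemma dot_suml (R : realType) (n : nat) (I : finType) (u : I -> 'rV[R]_n)
    (v : 'rV[R]_n) :
  dot (\sum_i u i) v = \sum_i dot (u i) v.
Proof.
rewrite /dot exchange_big; apply: eq_bigr => j _.
by rewrite summxE big_distrl.
Qed.

Lemma dot_self_ge0 (R : realType) (n : nat) (u : 'rV[R]_n) : 0 <= dot u u.
Proof. by apply: sumr_ge0 => j _; rewrite -expr2 sqr_ge0. Qed.

Lemma ler_coord_mx_norm (R : realType) (n : nat) (u : 'rV[R]_n) j :
  `|u 0 j| <= `|u|.
Proof. by rewrite [leRHS]mx_normrE (le_bigmax _ _ (0, j)). Qed.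

(** A coordinate attaining the sup norm already contributes its square to the sum. *)
Lemma sqr_mx_norm_le_dot (R : realType) (n : nat) (u : 'rV[R]_n) :
  `|u| ^+ 2 <= dot u u.
Proof.
have [->|/mx_norm_neq0[[i j] /= e]] := eqVneq `|u| 0.
  by rewrite expr0n dot_self_ge0.
rewrite {1}/Num.norm /= e ord1 real_normK ?num_real// /dot (bigD1 j)//= -expr2.
by rewrite lerDl; apply: sumr_ge0 => k _; rewrite -expr2 sqr_ge0.
Qed.

Lemma dot_self_gt0 (R : realType) (n : nat) (u : 'rV[R]_n) :
  u != 0 -> 0 < dot u u.
Proof.
move=> u0; apply: lt_le_trans (sqr_mx_norm_le_dot u).
by rewrite exprn_gt0 ?normr_gt0.
Qed.

Lemma dot_le_mx_norm (R : realType) (n : nat) (u v : 'rV[R]_n) :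
  dot u v <= (\sum_j `|u 0 j|) * `|v|.
Proof.
rewrite big_distrl; apply: ler_sum => j _; apply: le_trans (ler_norm _) _.
by rewrite normrM ler_wpM2l// ler_coord_mx_norm.
Qed.

Lemma enormZ (R : realType) (n : nat) (a : R) (u : 'rV[R]_n) :
  0 <= a -> enorm (a *: u) = a * enorm u.
Proof.
move=> a0; rewrite /enorm dotZl dotZr mulrA -expr2.
by rewrite sqrtrM ?sqr_ge0// sqrtr_sqr ger0_norm.
Qed.

Lemma sqr_enorm (R : realType) (n : nat) (u : 'rV[R]_n) :
  enorm u ^+ 2 = dot u u.
Proof. by rewrite sqr_sqrtr// dot_self_ge0. Qed.

Lemma enorm_gt0 (R : realType) (n : nat) (u : 'rV[R]_n) : u != 0 -> 0 < enorm u.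
Proof. by move=> u0; rewrite sqrtr_gt0 dot_self_gt0. Qed.

Lemma cvg_dot (R : realType) (n : nat) (T : Type) (F : set_system T)
    {FF : Filter F} (f g : T -> 'rV[R]_n) (a b : 'rV[R]_n) :
  f @ F --> a -> g @ F --> b -> dot (f x) (g x) @[x --> F] --> dot a b.
Proof.
move=> fa gb; apply: cvg_big => [|j _]; first exact: add_continuous.
by apply: cvgM; [move: fa | move: gb] =>
  /(cvg_comp _ (fun M : 'rV[R]_n => M 0 j)); apply; exact: coord_continuous.
Qed.

(** * Frechet normals, and normals to cones at the origin *)

(** Dividing by the norm leaves a quotient of at most [C * enorm (y - xbar)], which vanishes in the
    limit. *)
Lemma frechet_normal_of_quadratic_bound (R : realType) (n : nat) (C : R)
    (xbar u : 'rV[R]_n) (Omega : set 'rV[R]_n) :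
  (forall y, Omega y -> dot u (y - xbar) <= C * dot (y - xbar) (y - xbar)) ->
  frechet_normal xbar Omega u.
Proof.
move=> uC; apply/lee_addgt0Pr => e e0; rewrite add0e.
(* The limsup is an infimum of suprema, so one set of the filter with supremum at most [e]
   suffices. *)
pose V := [set y | [/\ Omega y, y != xbar & C * enorm (y - xbar) < e]].
apply: (@le_trans _ _ (ereal_sup
    ((fun y => (dot u (y - xbar) / enorm (y - xbar))%:E) @` V))).
  apply: ereal_inf_lbound; exists V => //.
  have : \forall y \near xbar, C * enorm (y - xbar) < e.
    have : C * enorm (y - xbar) @[y --> xbar] --> (0 : R).
      have -> : 0 = C * enorm (xbar - xbar) :> R.
        by rewrite subrr /enorm dotr0 sqrtr0 mulr0.
      apply: (@cvgM _ _ (nbhs xbar)); first exact: cvg_cst.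
      apply: (@cvg_comp _ _ _ (fun y => dot (y - xbar) (y - xbar)) Num.sqrt _
        (nbhs (dot (xbar - xbar) (xbar - xbar)))); last exact: sqrt_continuous.
      by apply: (@cvg_dot _ _ _ (nbhs xbar)); apply: (@cvgB _ _ _ (nbhs xbar));
        try exact: cvg_cst; exact: cvg_id.
    by move/cvgr_lt; apply.
  by apply: filterS => y Cy yx Oy.
apply: ub_ereal_sup => _ [y [Oy yx Cy] <-].
have y0 : 0 < enorm (y - xbar) by rewrite enorm_gt0// subr_eq0.
rewrite lee_fin ler_pdivrMr// (le_trans (uC y Oy))// -sqr_enorm expr2 mulrA.
by rewrite ler_wpM2r// ltW.
Qed.

(** The ray through [v] stays in the cone, and the quotient is constant along it, so the limsup at 0
    dominates that constant. *)
Lemma frechet_normal0_cone_le0 (R : realType) (n : nat) (xs v : 'rV[R]_n)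
    (L : set 'rV[R]_n) :
  is_cone L -> frechet_normal 0 L xs -> L v -> dot xs v <= 0.
Proof.
move=> [_ Lcone] xsN Lv.
have [->|v0] := eqVneq v 0.
  by rewrite dotr0.
have ev : 0 < enorm v by exact: enorm_gt0.
suff: dot xs v / enorm v <= 0 by rewrite pmulr_lle0// invr_gt0.
apply/ler_addgt0Pr => e e0; rewrite add0r -lee_fin.
have /ereal_inf_lt[_ [V FV <-] Ve] : (limf_esup
    (fun x : 'rV[R]_n => (dot xs (x - 0)%R / enorm (x - 0)%R)%R%:E)
    (within L (0%R : 'rV[R]_n)^') < e%:E)%E.
  by apply: le_lt_trans xsN _; rewrite lte_fin.
apply: le_trans (ltW Ve).
have : \forall t \near (0 : R)^'+, V (t *: v).
  have cv : t *: v @[t --> (0 : R)^'+] --> (0 : 'rV[R]_n).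
    rewrite -[X in _ --> X](scale0r v); apply: cvg_at_right_filter.
    by apply: cvgZr_tmp; exact: cvg_id.
  have : \forall t \near (0 : R)^'+, t *: v != 0 -> L (t *: v) -> V (t *: v).
    exact: cv _ FV.
  move=> H; near=> t.
  have t0 : 0 < t by near: t; exact: nbhs_right_gt.
  have : t *: v != 0 -> L (t *: v) -> V (t *: v) by near: t.
  apply; first by rewrite scaler_eq0 negb_or gt_eqF.
  exact: Lcone (ltW t0) Lv.
move=> H; near (0 : R)^'+ => t.
have t0 : 0 < t by near: t; exact: nbhs_right_gt.
apply: ereal_sup_ubound; exists (t *: v); first by near: t.
rewrite subr0 dotZr enormZ ?ltW// -mulf_div divff ?mul1r// gt_eqF.
Unshelve. all: by end_near.
Qed.

(** The normal [xs] can be pushed slightly along [v] and remain normal, which raises its product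
    with [v] by [t * dot v v > 0]. *)
Lemma interior_frechet_normal0_cone_lt0 (R : realType) (n : nat)
    (xs v : 'rV[R]_n) (L : set 'rV[R]_n) :
  is_cone L -> interior (frechet_normal 0 L) xs -> L v -> v != 0 ->
  dot xs v < 0.
Proof.
move=> Lcone xsN Lv v0.
have : xs + t *: v @[t --> (0 : R)^'+] --> xs.
  rewrite -[X in _ --> X]addr0 -[X in _ + X](scale0r v).
  apply: cvg_at_right_filter; apply: cvgD; first exact: cvg_cst.
  by apply: cvgZr_tmp; exact: cvg_id.
move=> /(_ _ xsN) H; near (0 : R)^'+ => t.
have t0 : 0 < t by near: t; exact: nbhs_right_gt.
have : frechet_normal 0 L (xs + t *: v) by near: t.
move=> /(frechet_normal0_cone_le0 Lcone) /(_ Lv); rewrite dotDl dotZl.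
apply: lt_le_trans; rewrite ltrDl mulr_gt0// dot_self_gt0//.
Unshelve. all: by end_near.
Qed.

(* The proximal normals at [t *: w], [t > 0], do not depend on [t], so they
   survive when [t] tends to [0]. *)
Lemma limiting_normal0_cone_projection (R : realType) (n : nat) (x w : 'rV[R]_n)
    (L : set 'rV[R]_n) :
  is_cone L -> L w ->
  (forall y, L y -> dot (x - w) (x - w) <= dot (x - y) (x - y)) ->
  limiting_normal 0 L (x - w).
Proof.
move=> [L0 Lcone] Lw wmin.
exists (fun=> 0), (fun k => @harmonic R k *: w), (fun=> x - w).
split; split => //.
- exact: cvg_cst.
- by move=> k; apply: Lcone; rewrite ?harmonic_ge0.
- rewrite -[X in _ --> X](scale0r w); apply: cvgZr_tmp; exact: cvg_harmonic.
- exact: cvg_cst.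
move=> k; set t : R := harmonic k; have t0 : 0 < t by exact: harmonic_gt0.
(* With [p = x - w] and [q = z - w], minimality against [z] gives [2 <p, q> <= <q, q>]; since
   [y - t *: w = t *: q], rescaling yields the constant [1 / (2 t)]. *)
apply: (@frechet_normal_of_quadratic_bound _ _ (2^-1 / t)) => y Ly.
set z := t^-1 *: y.
have Lz : L z by apply: Lcone => //; rewrite invr_ge0 ltW.
have -> : y - t *: w = t *: (z - w).
  by rewrite scalerBr /z scalerA divff ?scale1r// gt_eqF.
have := wmin _ Lz.
have -> : x - z = (x - w) - (z - w) by rewrite opprB addrA subrK.
move: (x - w) (z - w) => p q.
rewrite !(dotDl, dotDr, dotNl, dotNr, dotZl, dotZr) (dotC q p).
move=> H; have -> : 2^-1 / t * (t * (t * dot q q)) = t * (2^-1 * dot q q).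
  by field; rewrite gt_eqF.
by rewrite ler_pM2l//; lra.
Qed.

(** * A uniform gap by compactness *)

(** Each point of [K] has a neighbourhood missing some [L i]. A single parameter [m] bounds the
    index and, through [harmonic m], the margin, so both conditions hold for all large [m]. *)
Lemma compact_uniformly_off_finite_subfamily (R : realType)
    (V : normedModType R) (K : set V) (L : nat -> set V) :
  compact K -> (forall i, closed (L i)) -> K `&` \bigcap_i L i = set0 ->
  exists N (d : R), 0 < d /\
    forall x, K x -> exists i : 'I_N, forall w, L i w -> d <= `|x - w|.
Proof.
move=> /compact_near_coveringP Kc Lc KL0.
pose P (m : nat) (x : V) :=
  exists i : 'I_m, forall w, L i w -> @harmonic R m <= `|x - w|.
suff KP : forall x, K x -> \forall y \near x & m \near \oo, P m y.
  have [m _ /(_ m (leqnn m)) KPm] := Kc nat \oo P _ KP.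
  by exists m, (harmonic m); split; [exact: harmonic_gt0 | exact: KPm].
move=> x Kx.
have [i Lix] : exists i, ~ L i x.
  apply: contrapT => /forallNP Lx.
  suff : (K `&` \bigcap_i L i) x by rewrite KL0.
  by split=> // i _; apply: contrapT; exact: Lx.
have /nbhs_normP[r /= r0 xr] : nbhs x (~` L i).
  by apply: open_nbhs_nbhs; split=> //; exact: closed_openC.
(* Points within [r / 2] of [x] keep distance [r / 2] from [L i], which misses the [r]-ball around
   [x]. *)
have r20 : 0 < r / 2 by rewrite divr_gt0.
near=> y m.
have im : (i < m)%N by near: m; exact: nbhs_infty_gt.
exists (Ordinal im) => w /= Lw.
apply: (@le_trans _ _ (r / 2)).
  by apply: ltW; near: m; exact: (cvgr_lt _ cvg_harmonic).
rewrite leNgt; apply/negP => yw.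
have xy : `|x - y| < r / 2 by near: y; apply: (@cvgr_dist_lt _ _ _ (nbhs x)).
apply: xr Lw; rewrite /ball_/= [r]splitr -(subrKA y x (- w)).
by apply: le_lt_trans (ler_normD _ _) _; exact: ltrD.
Unshelve. all: by end_near.
Qed.

(** * The penalty function and its minimizer *)

(** The first term uses the sup norm, so that [e] later bounds a sup-norm error; the squares are
    Euclidean, so that minimizing in [w] gives Euclidean projections. *)
Definition penalty (R : realType) (n N : nat) (xs : 'rV[R]_n) (e : R)
    (x : 'rV[R]_n) (w : 'I_N -> 'rV[R]_n) : R :=
  e * `|x| - dot xs x + 2^-1 * \sum_i dot (x - w i) (x - w i).

Import ArrowAsProduct.

Lemma penalty_continuous (R : realType) (n N : nat) (xs : 'rV[R]_n) (e : R) :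
  continuous (fun p : 'rV[R]_n * ('I_N -> 'rV[R]_n) => penalty xs e p.1 p.2).
Proof.
move=> p.
have c1 : q.1 @[q --> p] --> p.1 by exact: cvg_fst.
have c2 i : q.2 i @[q --> p] --> p.2 i.
  apply: (@cvg_comp _ _ _ snd (fun w : 'I_N -> 'rV[R]_n => w i) _ (nbhs p.2)).
    exact: cvg_snd.
  exact: proj_continuous.
apply: (@cvgD _ _ _ (nbhs p)).
  apply: (@cvgB _ _ _ (nbhs p)).
    apply: (@cvgM _ _ (nbhs p)); first exact: cvg_cst.
    exact: cvg_norm.
  by apply: cvg_dot => //; exact: cvg_cst.
apply: (@cvgM _ _ (nbhs p)); first exact: cvg_cst.
apply: cvg_big => [|i _]; first exact: add_continuous.
by apply: cvg_dot; apply: (@cvgB _ _ _ (nbhs p)).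
Qed.

(** The penalty is 0 at the origin, so only points with nonpositive penalty compete, and the gap [d]
    confines these to a compact set. *)
Lemma penalty_minimizer (R : realType) (n N : nat) (xs : 'rV[R]_n) (e d : R)
    (L : 'I_N -> set 'rV[R]_n) :
  (forall i, closed (L i)) -> (forall i, L i 0) -> 0 <= e -> 0 < d ->
  (forall x w, (forall i, L i (w i)) -> x != 0 -> e * `|x| <= dot xs x ->
    exists i, d * `|x| <= `|x - w i|) ->
  exists x w, (forall i, L i (w i)) /\
    forall y v, (forall i, L i (v i)) -> penalty xs e x w <= penalty xs e y v.
Proof.
move=> Lc L0 e0 d0 Ld.
pose C := \sum_j `|xs 0 j|; have C0 : 0 <= C by exact: sumr_ge0.
(* Nonpositive penalty gives [(d |x|)^2 <= |x - w i|^2 <= 2 C |x|] for some [i], hence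
   [|x| <= B]. *)
pose B := 2 * C / d ^+ 2.
have B0 : 0 <= B by rewrite divr_ge0 ?sqr_ge0// mulr_ge0.
(* Every [|x - w i|^2] is at most [2 C B], and [s <= 1 + s^2] then bounds [|x - w i|]; adding
   [|x| <= B] bounds [w i]. *)
pose M := B + (1 + 2 * C * B).
have CB0 : 0 <= 2 * C * B by rewrite mulr_ge0// mulr_ge0.
have M0 : 0 <= M by rewrite /M; lra.
have bounded x w : (forall i, L i (w i)) -> penalty xs e x w <= 0 ->
    `|x| <= M /\ forall i, `|w i| <= M.
  move=> Lw; rewrite /penalty => p0.
  have sq0 i : 0 <= dot (x - w i) (x - w i) by exact: dot_self_ge0.
  have s0 : 0 <= \sum_i dot (x - w i) (x - w i) by exact: sumr_ge0.
  have sle i : `|x - w i| ^+ 2 <= \sum_i dot (x - w i) (x - w i).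
    apply: le_trans (sqr_mx_norm_le_dot _) _; rewrite (bigD1 i)//= lerDl.
    exact: sumr_ge0.
  have xsx : e * `|x| <= dot xs x by lra.
  have S2C : \sum_i dot (x - w i) (x - w i) <= 2 * C * `|x|.
    have := dot_le_mx_norm xs x; rewrite -/C.
    by have := mulr_ge0 e0 (normr_ge0 x); lra.
  have xB : `|x| <= B.
    have [->|x0] := eqVneq x 0; first by rewrite normr0.
    have [i dxi] := Ld x w Lw x0 xsx.
    have xgt0 : 0 < `|x| by rewrite normr_gt0.
    rewrite ler_pdivlMr ?exprn_gt0//.
    rewrite -(ler_pM2r xgt0); apply: le_trans S2C; apply: le_trans (sle i).
    rewrite mulrAC -expr2 -exprMn mulrC.
    by apply: lerXn2r; rewrite ?nnegrE ?(mulr_ge0 (ltW d0)).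
  split=> [|i]; first by apply: le_trans xB _; rewrite /M; lra.
  have xwi : `|x - w i| <= 1 + 2 * C * B.
    have S2B : 2 * C * `|x| <= 2 * C * B by rewrite ler_wpM2l// mulr_ge0.
    have := sle i; have := sqr_ge0 (`|x - w i| - 1); rewrite sqrrB1; nra.
  have -> : w i = x - (x - w i) by rewrite subKr.
  by apply: le_trans (ler_normB _ _) _; exact: lerD.
pose K := [set x : 'rV[R]_n | `|x| <= M] `*`
  [set w : 'I_N -> 'rV[R]_n | forall i, (L i `&` [set y | `|y| <= M]) (w i)].
have ballc : compact [set x : 'rV[R]_n | `|x| <= M].
  apply: bounded_closed_compact.
    exists M; split; first exact: num_real.
    by move=> r Mr x /= xM; exact: le_trans xM (ltW Mr).
  apply: (@preimage_closed _ _ (fun x : 'rV[R]_n => `|x|) [set r : R | r <= M]).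
    by move=> x _; exact: norm_continuous.
  exact: closed_le.
have Kc : compact K.
  apply: compact_setX => //.
  apply: (@tychonoff 'I_N (fun=> 'rV[R]_n)
    (fun i => L i `&` [set y | `|y| <= M])) => i.
  by rewrite setIC; exact: compact_closedI.
have K0 : K (0, fun=> 0).
  by split=> /= [|i]; rewrite ?normr0//; split=> //=; rewrite normr0.
have [] := @compact_EVT_min _ R (fun p : 'rV[R]_n * ('I_N -> 'rV[R]_n) =>
  penalty xs e p.1 p.2) K (ex_intro _ _ K0) Kc _.
  by apply: continuous_subspaceT; exact: penalty_continuous.
move=> [x w] /set_mem[/= xM wM] xwmin.
have p00 : penalty xs e 0 (fun _ : 'I_N => 0) = 0.
  rewrite /penalty normr0 mulr0 dotr0 subr0 add0r big1 ?mulr0// => i _.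
  by rewrite subr0 dotr0.
exists x, w; split=> [i|y v Lv]; first by have [] := wM i.
(* A competitor with nonpositive penalty lies in [K]; any other is beaten by the origin. *)
have [p0|/ltW p0] := leP (penalty xs e y v) 0.
  have [yM vM] := bounded _ _ Lv p0.
  by apply: (xwmin (y, v)); rewrite inE; split=> //= i; split.
apply: le_trans p0; rewrite -p00; apply: (xwmin (0, fun=> 0)); exact: mem_set.
Qed.

(** * Normals extracted from minimality *)

Lemma frechet_normal_approx_finite_sum (R : realType) (n : nat)
    (L : nat -> set 'rV[R]_n) (xs : 'rV[R]_n) (e : R) :
  (forall i, closed (L i)) -> (forall i, is_cone (L i)) -> 0 <= e ->
  (forall v, (\bigcap_i L i) v -> v != 0 -> dot xs v < e * `|v|) ->
  exists N (u : 'I_N -> 'rV[R]_n),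
    (forall i : 'I_N, limiting_normal 0 (L i) (u i)) /\ `|xs - \sum_i u i| <= e.
Proof.
move=> Lc Lcone e0 xsL.
pose K := [set x : 'rV[R]_n | `|x| = 1 /\ e * `|x| <= dot xs x].
have Kc : compact K.
  apply: bounded_closed_compact.
    exists 1; split; [exact: num_real | move=> r r1 x [/= -> _]; exact: ltW].
  have -> : K = (fun x : 'rV[R]_n => `|x|) @^-1` [set r : R | r = 1] `&`
      (fun x => e * `|x| - dot xs x) @^-1` [set r : R | r <= 0].
    apply/seteqP; split=> x [x1 xsx]; split=> //; move: xsx;
      by rewrite /= subr_le0.
  apply: closedI.
    apply: preimage_closed; last exact: closed_eq.
    by move=> x _; exact: norm_continuous.
  apply: preimage_closed; last exact: closed_le.
  move=> x _; apply: (@cvgB _ _ _ (nbhs x)).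
    by apply: (@cvgM _ _ (nbhs x)); [exact: cvg_cst | exact: norm_continuous].
  by apply: (@cvg_dot _ _ _ (nbhs x)); [exact: cvg_cst | exact: cvg_id].
have KL0 : K `&` \bigcap_i L i = set0.
  apply/seteqP; split=> // x [[x1 xsx] Lx].
  have x0 : x != 0 by rewrite -normr_eq0 x1 oner_neq0.
  by have := xsL x Lx x0; rewrite ltNge xsx.
have [N [d [d0 Kd]]] := compact_uniformly_off_finite_subfamily Kc Lc KL0.
have [||x w Lw x0 xsx|x [w [Lw xwmin]]] := @penalty_minimizer _ _ N xs e d
  (fun i => L i) _ _ e0 d0.
- by move=> i.
- by move=> i; have [] := Lcone i.
- have xgt0 : 0 < `|x| by rewrite normr_gt0.
  have nx : `| `|x|^-1 | = `|x|^-1 by rewrite ger0_norm// invr_ge0.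
  (* The gap is known on the unit sphere only; scaling [x] and [w i] together, which the cone
     allows, carries it to every [x]. *)
  have [|i iK] := Kd (`|x|^-1 *: x).
    have nx1 : `| `|x|^-1 *: x | = 1 by rewrite normrZ nx mulVf ?gt_eqF.
    split=> //; rewrite nx1 mulr1 dotZr -(ler_pM2l xgt0) mulrA divff ?gt_eqF//.
    by rewrite mul1r mulrC.
  exists i; have := iK (`|x|^-1 *: w i); rewrite -scalerBr normrZ nx.
  rewrite ler_pdivlMl// mulrC; apply.
  by apply: (Lcone i).2; rewrite ?invr_ge0.
exists N, (fun i => x - w i); split=> [i|].
  apply: limiting_normal0_cone_projection => // y Ly.
  (* Changing only the [i]-th point leaves a single square to compare, so [w i] is a projection of
     [x]. *)
  pose v (j : 'I_N) := if j == i then y else w j.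
  have Lv (j : 'I_N) : L j (v j) by rewrite /v; case: eqP => [->|_].
  have := xwmin x v Lv; rewrite /penalty (bigD1 i)//=.
  have -> : \sum_j dot (x - v j) (x - v j) =
      dot (x - y) (x - y) + \sum_(j | j != i) dot (x - w j) (x - w j).
    rewrite (bigD1 i)//= /v eqxx; congr (_ + _).
    by apply: eq_bigr => j /negPf ->.
  lra.
(* The residual [u] is itself the direction in which [x] is varied. *)
set u := xs - _.
have uE : \sum_i (x - w i) = xs - u by rewrite subKr.
clearbody u.
have [->//|u0] := eqVneq `|u| 0.
have ugt0 : 0 < `|u| by rewrite lt_def u0 normr_ge0.
rewrite -(ler_pM2r ugt0) -expr2; apply: le_trans (sqr_mx_norm_le_dot u) _.
have uu := dot_self_ge0 u.
have Du : 0 < N%:R * dot u u + 1 by rewrite ltr_wpDl// mulr_ge0.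
(* Moving [x] by [t *: u] and dividing by [t] gives [dot u u <= e |u| + t N (dot u u) / 2]. This [t]
   makes the last term at most [r]; the added 1 keeps the denominator positive even for [N = 0]. *)
apply/ler_addgt0Pr => r r0; pose t := r / (N%:R * dot u u + 1).
have t0 : 0 < t by exact: divr_gt0.
have tu : t * (N%:R * dot u u) <= r.
  by rewrite /t mulrAC ler_pdivrMr// ler_pM2l// lerDl.
have := xwmin (x + t *: u) w Lw; rewrite /penalty.
have -> : \sum_i dot (x + t *: u - w i) (x + t *: u - w i) =
    \sum_i dot (x - w i) (x - w i) + 2 * t * dot (\sum_i (x - w i)) u
    + t ^+ 2 * (N%:R * dot u u).
  have -> : t ^+ 2 * (N%:R * dot u u) = \sum_(i < N) t ^+ 2 * dot u u.
    by rewrite sumr_const card_ord -[RHS]mulr_natl mulrCA.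
  rewrite dot_suml mulr_sumr -!big_split /=; apply: eq_bigr => i _.
  rewrite [x + _ - _]addrAC; move: (x - w i) => p.
  by rewrite !(dotDl, dotDr, dotZl, dotZr) (dotC u p); ring.
rewrite uE.
have := ler_normD x (t *: u); rewrite normrZ (gtr0_norm t0) => /(ler_wpM2l e0).
rewrite dotDr dotZr dotDl dotNl => n1 n2.
rewrite -(ler_pM2l t0).
have := ler_wpM2l (ltW t0) tu.
set A := N%:R * dot u u in n2 *.
by have := mulr_ge0 (sqr_ge0 t) (mulr_ge0 (ler0n R N) uu); rewrite -/A; nra.
Qed.

Lemma limiting_normal0_cone_zero (R : realType) (n : nat) (L : set 'rV[R]_n) :
  is_cone L -> limiting_normal 0 L 0.
Proof.
move=> Lcone; have [L0 _] := Lcone.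
rewrite -[X in limiting_normal _ _ X](subrr 0).
apply: limiting_normal0_cone_projection => // y _.
by rewrite subrr dotr0 dot_self_ge0.
Qed.

(** Since 0 is always a limiting normal, the finite family extends by 0 to a sequence usable both as
    a series and as a finite sum. *)
Lemma frechet_normal_approx_normals (R : realType) (n : nat)
    (L : nat -> set 'rV[R]_n) (xs : 'rV[R]_n) (e : R) :
  (forall i, closed (L i)) -> (forall i, is_cone (L i)) -> 0 <= e ->
  (forall v, (\bigcap_i L i) v -> v != 0 -> dot xs v < e * `|v|) ->
  exists N (x : nat -> 'rV[R]_n),
    [/\ forall i, limiting_normal 0 (L i) (x i),
        forall i, (N <= i)%N -> x i = 0 &
        `|xs - \sum_(i < N) x i| <= e].
Proof.
move=> Lc Lcone e0 xsL.
have [N [u [uN xsu]]] := frechet_normal_approx_finite_sum Lc Lcone e0 xsL.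
exists N, (fun i => oapp u 0 (insub i)); split=> [i|i Ni|].
- case: insubP => [j _ <-|_] /=.
    exact: uN.
  exact: limiting_normal0_cone_zero.
- by rewrite insubN// -leqNgt.
- by under eq_bigr => i _ do rewrite valK.
Qed.

Theorem theorem5p4 (R : realType) (n : nat) (L : nat -> set 'rV[R]_n)
  (L_closed : forall i, closed (L i))
  (L_cone : forall i, is_cone (L i))
  (L_nqc : normal_qualification L) :
  interior (frechet_normal 0 (\bigcap_i L i)) `<=` normal_series_sums L /\
  frechet_normal 0 (\bigcap_i L i) `<=` closure (normal_finite_sums L).
Proof.
have capcone : is_cone (\bigcap_i L i).
  split=> [i _|a v a0 Lv i _]; first exact: (L_cone i).1.
  by apply: (L_cone i).2 => //; exact: Lv.
split=> xs xsN.
(* Strict negativity on the intersection allows [e = 0]: the finite sum is exactly [xs], and the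
   partial sums are constant from [N] on. *)
- have [|N [x [xN x0 xsx]]] :=
      frechet_normal_approx_normals L_closed L_cone (lexx 0) _ (xs := xs).
    move=> v Lv v0; rewrite mul0r.
    exact: interior_frechet_normal0_cone_lt0 capcone xsN Lv v0.
  exists x; split=> //; apply: cvg_near_cst; exists N => // m /= Nm.
  rewrite /series /= (big_cat_nat (leq0n N) Nm) /= [X in _ + X]big1_seq ?addr0.
    rewrite big_mkord; apply/esym/eqP; rewrite -subr_eq0 -normr_le0.
    exact: xsx.
  by move=> i; rewrite mem_index_iota => /andP[_ /andP[/x0]].
- move=> V /nbhs_normP[r /= r0 xsV].
  (* The approximation error is bounded non-strictly, so [e = r / 2] places the sum inside the open
     [r]-ball. *)
  have r20 : 0 < r / 2 by rewrite divr_gt0.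
  have [|N [x [xN _ xsx]]] :=
      frechet_normal_approx_normals L_closed L_cone (ltW r20) _ (xs := xs).
    move=> v Lv v0.
    apply: le_lt_trans (frechet_normal0_cone_le0 capcone xsN Lv) _.
    by rewrite mulr_gt0// normr_gt0.
  exists (\sum_(i < N) x i); split.
    by exists `I_N, x; split; rewrite ?fsbig_ord// => i _; exact: xN.
  by apply: xsV; rewrite /ball_/=; apply: le_lt_trans xsx _; lra.
Qed.
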